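(* Let $q$ be a prime power, let $m\ge1$, $s\ge1$, $u\ge0$ and $r\ge2$ be integers, and let $\mathbf{e}=(e_1,\dots,e_s)\in\mathbb{N}^s$. If there exists a digital $(u,m,\mathbf{e},s)$-net over $\mathbb{F}_{q^r}$, then there exists a digital $((r-1)m-(r-1)+u,\ rm-(r-1),\ \mathbf{e},\ s)$-net over $\mathbb{F}_q$.
   Context: $\mathbb{N}$ denotes the positive integers, $\lambda_s$ Lebesgue measure. An elementary interval in base $b$ is $J=\prod_{i=1}^s[a_ib^{-d_i},(a_i+1)b^{-d_i})$ with integers $d_i\ge0$, $0\le a_i<b^{d_i}$. For integers $0\le u\le m$ and $\mathbf{e}=(e_1,\dots,e_s)\in\mathbb{N}^s$, a set of $b^m$ points in $[0,1)^s$ is a $(u,m,\mathbf{e},s)$-net in base $b$ if every elementary interval $J$ in base $b$ with $\lambda_s(J)\ge b^{u-m}$ and $e_i\mid d_i$ for all $i$ contains exactly $b^m\lambda_s(J)$ of the points. Digital net over a finite field $\mathbb{F}_Q$ ($Q$ a prime power): given $m\times m$ generating matrices $C_1,\dots,C_s$ over $\mathbb{F}_Q$, bijections $\eta_r:Z_Q\to\mathbb{F}_Q$ ($0\le r<m$) and $\kappa_{i,j}:\mathbb{F}_Q\to Z_Q$ where $Z_Q=\{0,\dots,Q-1\}$, for $0\le n<Q^m$ with base-$Q$ digits $n_0,\dots,n_{m-1}$ put $(y^{(i)}_{n,1},\dots,y^{(i)}_{n,m})^\top=C_i(\eta_0(n_0),\dots,\eta_{m-1}(n_{m-1}))^\top$,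 $x_n^{(i)}=\sum_{j=1}^m\kappa_{i,j}(y^{(i)}_{n,j})Q^{-j}$, $\mathbf{x}_n=(x_n^{(1)},\dots,x_n^{(s)})$. The resulting point set is a digital net over $\mathbb{F}_Q$; it is a digital $(u,m,\mathbf{e},s)$-net over $\mathbb{F}_Q$ if it is a $(u,m,\mathbf{e},s)$-net in base $Q$. *)

(* Defs.v *)
From HB Require Import structures.
From mathcomp Require Import all_boot all_order all_algebra.
From mathcomp Require Import all_classical all_reals all_analysis.

Set Implicit Arguments.
Unset Strict Implicit.
Unset Printing Implicit Defensive.

Import Order.TTheory GRing.Theory Num.Theory.
Local Open Scope classical_set_scope.
Local Open Scope ring_scope.

Definition prime_power (q : nat) : Prop :=
  exists p k : nat, [/\ prime p, (0 < k)%N & q = (p ^ k)%N].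

(* Lebesgue measure on R^s as the s-fold product of the one-dimensional
   measure: the successor case is the section formula by which the library
   defines the product [lebesgue_measure \x lebesgueN R s], with R^(s+1)
   identified with R * R^s through [cons_tuple]. *)
Fixpoint lebesgueN (R : realType) (s : nat) : set (s.-tuple R) -> \bar R :=
  match s with
  | 0%N => fun A => (\1_A [tuple])%:E
  | s'.+1 => fun A =>
      (\int[@lebesgue_measure R]_x
         lebesgueN [set t : s'.-tuple R | A (cons_tuple x t)])%E
  end.

Lemma lebesgueN_box (R : realType) (s : nat) (l h : 'I_s -> R) :
  (forall i, l i <= h i) ->
  lebesgueN [set x : s.-tuple R | forall i, l i <= tnth x i < h i] =
  (\prod_(i < s) (h i - l i))%:E.
Proof.
elim: s l h => [|s IH] l h lh /=.
  rewrite big_ord0 indicE mem_set //; first by case.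
rewrite big_ord_recl.
have -> : (fun x => lebesgueN [set t : s.-tuple R |
                      forall i, l i <= tnth (cons_tuple x t) i < h i]) =
          (fun x => (\prod_(i < s) (h (lift ord0 i) - l (lift ord0 i)))%:E *
                    (\1_`[l ord0, h ord0[ x)%:E)%E.
  apply/funext => x; rewrite indicE.
  have [xi|xi] := boolP (x \in `[l ord0, h ord0[%classic).
    rewrite mule1 -IH; last by move=> i; exact: lh.
    congr lebesgueN; apply/seteqP; split => t /= H i.
      by have := H (lift ord0 i); rewrite tnthS.
    have [j ->|->] := unliftP ord0 i; first by rewrite tnthS; exact: H.
    by move: xi; rewrite inE /= in_itv.
  rewrite mule0.
  rewrite (_ : [set t | _] = set0).
    elim: (s) => [|k IHk] /=; first by rewrite indicE in_set0.
    by rewrite (eq_integral (cst 0%E)) ?integral0// => y _.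
  apply/seteqP; split => // t /= /(_ ord0) H.
  by move: xi; rewrite notin_setE /= in_itv /=; apply.
rewrite integralZl//; last exact: integrable_indic_itv.
rewrite integral_indic// setIT.
rewrite [X in (_ * X)%E](_ : _ = lebesgue_measure `[l ord0, h ord0[%classic)//.
rewrite lebesgue_measure_itv /= lte_fin.
case: ltP => [lt|le]; first by rewrite -EFinD -EFinM mulrC.
have -> : h ord0 = l ord0 by apply/eqP; rewrite eq_le le lh.
by rewrite mule0 subrr mul0r.
Qed.

(* prod_i [a_i b^-d_i, (a_i + 1) b^-d_i) *)
Definition elementary_interval (R : realType) (s b : nat) (d a : 'I_s -> nat)
    : set (s.-tuple R) :=
  [set x | forall i : 'I_s,
     (a i)%:R / b%:R ^+ d i <= tnth x i < (a i).+1%:R / b%:R ^+ d i].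

(* A point set is a family indexed by 'I_(b ^ m), so that points are counted
   with multiplicity. *)
Definition is_net (R : realType) (b u m s : nat) (e : 'I_s -> nat)
    (x : 'I_(b ^ m) -> s.-tuple R) : Prop :=
  [/\ (u <= m)%N,
      forall n i, 0 <= tnth (x n) i < 1
    & forall d a : 'I_s -> nat,
        (forall i, (a i < b ^ d i)%N) ->
        (forall i, (e i %| d i)%N) ->
        let J : set (s.-tuple R) := elementary_interval b d a in
        ((b%:R ^ (u%:Z - m%:Z))%:E <= lebesgueN J)%E ->
        (#|[pred n | x n \in J]|%:R%:E = (b ^ m)%:R%:E * lebesgueN J)%E].

(* Z_Q is 'I_Q; digit F n k is the coefficient of Q^k in n, for Q = #|F|. *)
Definition digit (F : finFieldType) (n k : nat) : 'I_#|F| :=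
  Ordinal (ltn_pmod (n %/ #|F| ^ k) (ltnW (card_finNzRing_gt1 F))).

(* Indices j : 'I_m start at 0, hence the weight Q^-(j+1). *)
Definition digital_point (R : realType) (F : finFieldType) (m s : nat)
    (C : 'I_s -> 'M[F]_m) (eta : 'I_m -> 'I_#|F| -> F)
    (kappa : 'I_s -> 'I_m -> F -> 'I_#|F|) (n : nat) : s.-tuple R :=
  [tuple
     let y := C i *m \col_(k < m) eta k (digit F n k) in
     \sum_(j < m) (kappa i j (y j 0))%:R / #|F|%:R ^+ j.+1
   | i < s].

Definition digital_net (R : realType) (F : finFieldType) (m s : nat)
    (x : 'I_(#|F| ^ m) -> s.-tuple R) : Prop :=
  exists (C : 'I_s -> 'M[F]_m) (eta : 'I_m -> 'I_#|F| -> F)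
         (kappa : 'I_s -> 'I_m -> F -> 'I_#|F|),
    [/\ forall k, bijective (eta k),
        forall i j, bijective (kappa i j)
      & forall n, x n = digital_point R C eta kappa n].

Definition is_digital_net (R : realType) (F : finFieldType) (u m s : nat)
    (e : 'I_s -> nat) (x : 'I_(#|F| ^ m) -> s.-tuple R) : Prop :=
  @digital_net R F m s x /\ @is_net R #|F| u m s e x.

(* Main.v *)
From HB Require Import structures.
Require Import Defs.
From mathcomp Require Import all_boot all_order all_algebra.
From mathcomp Require Import all_fingroup all_solvable all_field.
From mathcomp Require Import all_classical all_reals all_analysis.
From mathcomp Require Import zify.

Set Implicit Arguments.
Unset Strict Implicit.
Unset Printing Implicit Defensive.

(** A digital net is a (u, m, e, s)-net exactly when, for all d with e_i | d_i
    and sum_i d_i <= m - u, the first d_i rows of the C_i are jointly linearly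
    independent.  Rescale every row over F_Q so that its first coordinate is 0
    or 1.  An F_q-combination of such rows has its first coordinate in F_q, so
    this coordinate needs only one F_q-component, whereas each of the other
    m - 1 coordinates is expanded into its r components over F_q.  The
    resulting vectors have length 1 + r (m - 1) = r m - (r - 1), and an
    F_q-relation between them is an F_Q-relation between the original rows. *)

Import Order.TTheory GRing.Theory Num.Theory.
Local Open Scope ring_scope.

(** * Finite fields: embeddings and coordinates *)

Lemma finField_prim_root (F : finFieldType) :
  exists g : F, (#|F|.-1).-primitive_root g.
Proof.
have F1 : (0 < #|F|.-1)%N by rewrite -subn1 subn_gt0 finNzRing_gt1.
have /hasP[g _ gP] : has (#|F|.-1).-primitive_root (enum (predC1 (0 : F))).
  apply: has_prim_root => //; last by rewrite -cardE cardC1.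
    apply/allP => x; rewrite mem_enum => x0.
    apply/unity_rootP/(mulfI x0); rewrite mulr1 -exprS prednK ?expf_card //.
    exact: leq_trans F1 (leq_pred _).
  exact: enum_uniq.
by exists g.
Qed.

Lemma finField_embedding (p k r : nat) (F L : finFieldType) :
  prime p -> (0 < r)%N -> #|F| = (p ^ k)%N ->
  #|L| = (#|F| ^ r)%N -> exists f : F -> L, zmod_morphism f /\ monoid_morphism f.
Proof.
move=> pr_p r_gt0 cF cL.
have chF := card_finPcharP cF pr_p.
have chL : p \in [pchar L].
  by apply: (@card_finPcharP L p (k * r)) => //; rewrite cL cF expnM.
pose K : splittingFieldType 'F_p := pPrimeCharType chF.
pose A : fieldExtType 'F_p := pPrimeCharType chL.
have [g gP] := finField_prim_root F.
(* With [g] a generator of the units of [F] and [z] a root in [L] of its minimal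
   polynomial over the prime field, the embedding sends [a.[g]] to [a.[z]]. *)
pose evF (a : {poly 'F_p}) : F := (map_poly (in_alg K) a).[g].
have evFB a b : evF (a - b) = evF a - evF b by rewrite /evF rmorphB hornerD hornerN.
have evFM a b : evF (a * b) = evF a * evF b by rewrite /evF rmorphM hornerM.
have evF_surj (x : F) : exists a, evF a == x.
  have [->|x0] := eqVneq x 0; first by exists 0; rewrite /evF rmorph0 horner0.
  have [|i ->] := prim_rootP gP (x := x).
    apply/(mulfI x0); rewrite mulr1 -exprS prednK ?expf_card //.
    exact: ltnW (finNzRing_gt1 F).
  by exists 'X^i; rewrite /evF map_polyXn hornerXn.
have /polyOver1P[h hP] := minPolyOver (1%AS : {subfield K}) g.
have h_dvd a : evF a = 0 -> h %| a.
  move=> a0; rewrite -(dvdp_map (in_alg K)) -hP; apply: minPoly_dvdp.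
    by apply/polyOver1P; exists a.
  by rewrite rootE; apply/eqP.
have h_size : (1 < size h)%N.
  by rewrite -(size_map_poly (in_alg K)) -hP size_minPoly.
have [z zP] : exists z : A, root (map_poly (in_alg A) h) z.
  (* Since [#|L|] is a power of [#|F|], [g] is a root of ['X^#|L| - 'X], so [h] divides this
     polynomial, which splits over [L]. *)
  have : map_poly (in_alg A) h %| \prod_(x <- enum L) ('X - x%:P).
    rewrite big_enum -finField_genPoly.
    rewrite (_ : _ - _ = map_poly (in_alg A) ('X^#|L| - 'X)).
      rewrite dvdp_map; apply: h_dvd.
      rewrite /evF rmorphB /= map_polyXn map_polyX !hornerE cL.
      by elim: r {r_gt0 cL} => [|r IH]; rewrite ?subrr // expnSr exprM expf_card.
    by rewrite rmorphB /= map_polyXn map_polyX.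
  move=> /dvdp_prod_XsubC[s hs].
  have : (1 < size (map_poly (in_alg A) h))%N by rewrite size_map_poly.
  rewrite (eqp_size hs); case: (mask _ _) hs => [|z t] hs.
    by rewrite big_nil size_poly1.
  by exists z; rewrite (eqp_root hs) root_prod_XsubC inE eqxx.
pose evL (a : {poly 'F_p}) : L := (map_poly (in_alg A) a).[z].
have evLP a b : evF a = evF b -> evL a = evL b.
  move=> /eqP; rewrite -subr_eq0 -evFB => /eqP /h_dvd.
  rewrite -(dvdp_map (in_alg A)) => /dvdpP[c /(congr1 (horner^~ z))].
  rewrite rmorphB hornerD hornerN hornerM (rootP zP) mulr0 => /eqP.
  by rewrite subr_eq0 => /eqP.
pose f x := evL (xchoose (evF_surj x)).
have fE a : f (evF a) = evL a.
  by apply/evLP/eqP; exact: (xchooseP (evF_surj (evF a))).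
have evK x : x = evF (xchoose (evF_surj x))
  by apply/esym/eqP; exact: (xchooseP (evF_surj x)).
exists f; split; last split.
- move=> x y; rewrite (evK x) (evK y) -evFB !fE.
  by rewrite /evL rmorphB hornerD hornerN.
- have -> : 1 = evF 1 by rewrite /evF rmorph1 hornerC.
  by rewrite fE /evL rmorph1 hornerC.
move=> x y; rewrite (evK x) (evK y) -evFM !fE.
by rewrite /evL rmorphM hornerM.
Qed.

(** Through [f], [L] is an [F]-vector space. A basis is built one vector at a time, a count of
    elements shows that it has length [r], and [psi] reads off coordinates in it. *)
Lemma finField_coordinates (F L : finFieldType) (f : F -> L) (r : nat) :
  zmod_morphism f -> monoid_morphism f -> #|L| = (#|F| ^ r)%N ->
  exists psi : L -> 'rV[F]_r,
    [/\ zmod_morphism psi, forall a x, psi (f a * x) = a *: psi x & injective psi].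
Proof.
move=> fA fM cL.
pose fR : {rmorphism F -> L} := HB.pack f (GRing.isZmodMorphism.Build _ _ f fA)
  (GRing.isMonoidMorphism.Build _ _ f fM).
pose comb n (b : 'rV[L]_n) (c : 'rV[F]_n) := \sum_(i < n) fR (c 0 i) * b 0 i.
have combB n b : zmod_morphism (comb n b).
  move=> c d; rewrite -sumrB; apply: eq_bigr => i _.
  by rewrite !mxE rmorphB mulrBl.
have combZ n b a c : comb n b (a *: c) = fR a * comb n b c.
  rewrite mulr_sumr; apply: eq_bigr => i _.
  by rewrite !mxE rmorphM mulrA.
have [n [b [comb_inj comb_surj]]] :
    exists n (b : 'rV[L]_n), injective (comb n b) /\ forall x, exists c, x = comb n b c.
  (* An injective [comb n b] that misses [x] stays injective after adjoining [x]
     to [b], and cardinality stops this process. *)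
  have step n : (exists n (b : 'rV[L]_n),
        injective (comb n b) /\ forall x, exists c, x = comb n b c) \/
      exists b : 'rV[L]_n, injective (comb n b).
    elim: n => [|n [|[b b_inj]]]; [|by left|].
      by right; exists 0 => c d _; rewrite [c]thinmx0 [d]thinmx0.
    have [/forallP ims|] := boolP [forall x, [exists c, x == comb n b c]].
      left; exists n, b; split=> // x.
      by have /existsP[c /eqP ->] := ims x; exists c.
    rewrite negb_forall => /existsP[x]; rewrite negb_exists => /forallP xP.
    right; exists (row_mx (x%:M : 'rV_1) b : 'rV_(1 + n)).
    have combE (c : 'rV_(1 + n)) : comb _ (row_mx (x%:M : 'rV_1) b) c =
        fR (lsubmx c 0 0) * x + comb n b (rsubmx c).
      rewrite /comb big_split_ord big_ord1 /= row_mxEl !mxE eqxx mulr1n.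
      by congr (_ + _); apply: eq_bigr => i _; rewrite row_mxEr !mxE.
    suff inj0 (c : 'rV_(1 + n)) : comb _ (row_mx (x%:M : 'rV_1) b) c = 0 -> c = 0.
      move=> c d /eqP; rewrite -subr_eq0 -combB => /eqP/inj0/eqP.
      by rewrite subr_eq0 => /eqP.
    rewrite combE => c0.
    (* A nonzero coefficient of [x] could be inverted, which would put [x] in the image of
       [comb n b]. *)
    have l0 : lsubmx c 0 0 = 0.
      apply/eqP/negPn/negP => nz.
      have := xP (- (lsubmx c 0 0)^-1 *: rsubmx c); rewrite combZ.
      move/eqP: c0; rewrite addrC addr_eq0 => /eqP ->.
      rewrite rmorphN mulrNN mulrA -rmorphM mulVf // rmorph1 mul1r.
      by rewrite eqxx.
    move: c0; rewrite l0 rmorph0 mul0r add0r => c0.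
    rewrite -[c]hsubmxK [lsubmx c]mx11_scalar l0.
    have -> : rsubmx c = 0.
      apply: b_inj; rewrite c0; have := combB _ b 0 0.
      by rewrite !subrr => ->.
    by rewrite raddf0 row_mx0.
  (* An injective [comb] of length [r.+1] would give [#|F| ^ r.+1 <= #|F| ^ r]. *)
  have [//|[b b_inj]] := step r.+1.
  have := leq_card _ b_inj; rewrite card_mx cL mul1n leq_exp2l ?ltnn //.
  exact: finNzRing_gt1.
have comb_surjb x : exists c, x == comb n b c.
  by have [c ->] := comb_surj x; exists c.
pose psi x := xchoose (comb_surjb x).
have psiK : cancel psi (comb n b).
  by move=> x; apply/esym/eqP; exact: (xchooseP (comb_surjb x)).
have nr : n = r.
  apply/eqP; rewrite -(@eqn_exp2l #|F|) ?finNzRing_gt1 // -cL -[n]mul1n -card_mx.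
  by rewrite eqn_leq (leq_card _ comb_inj) (leq_card _ (can_inj psiK)).
move: psi psiK; rewrite -nr => psi psiK; exists psi; split.
- by move=> x y; apply: comb_inj; rewrite combB !psiK.
- by move=> a x; apply: comb_inj; rewrite combZ !psiK.
exact: can_inj psiK.
Qed.

(** * Joint independence of leading rows and counting solutions *)

(* [inord] makes the row index a plain natural number; this is meaningful only
   for [d i <= n.+1]. *)
Definition rows_indep (F : fieldType) (s n : nat) (C : 'I_s -> 'M[F]_n.+1)
    (d : 'I_s -> nat) : Prop :=
  forall c : 'I_s -> nat -> F,
    (forall k, \sum_i \sum_(j < d i) c i j * C i (inord j) k = 0) ->
    forall i (j : 'I_(d i)), c i j = 0.

(** Pairing a relation [c] with a vector whose prescribed products are 1 at [(i0, j0)] and 0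
    elsewhere isolates [c i0 j0]. *)
Lemma rows_indep_of_surj (F : fieldType) (s n : nat) (C : 'I_s -> 'M[F]_n.+1)
    (d : 'I_s -> nat) :
  (forall w : 'I_s -> nat -> F, exists v : 'cV_n.+1,
     forall i (j : 'I_(d i)), (C i *m v) (inord j) 0 = w i j) ->
  rows_indep C d.
Proof.
move=> surj c c0 i0 j0.
have [v vP] := surj (fun i j => ((i == i0) && (j == j0 :> nat))%:R).
have : \sum_k (\sum_i \sum_(j < d i) c i j * C i (inord j) k) * v k 0 = 0.
  by rewrite big1 // => k _; rewrite c0 mul0r.
under eq_bigr => k _ do rewrite mulr_suml.
rewrite exchange_big (bigD1 i0) //= [X in _ + X]big1 => [|i ii0].
  under eq_bigr => k _ do rewrite mulr_suml.
  rewrite exchange_big (bigD1 j0) //= [X in _ + X + _]big1 => [|j jj0].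
    under eq_bigr => k _ do rewrite -mulrA.
    rewrite -mulr_sumr; have := vP _ j0; rewrite !mxE => ->.
    by rewrite !eqxx mulr1 !addr0.
  under eq_bigr => k _ do rewrite -mulrA.
  rewrite -mulr_sumr; have := vP _ j; rewrite !mxE => ->.
  by rewrite (negPf (jj0 : j != j0 :> nat)) andbF mulr0.
under eq_bigr => k _ do rewrite mulr_suml.
rewrite exchange_big big1 // => j _.
under eq_bigr => k _ do rewrite -mulrA.
rewrite -mulr_sumr; have := vP _ j; rewrite !mxE => ->.
by rewrite (negPf ii0) mulr0.
Qed.

Lemma card_solutions (F : finFieldType) (k n : nat) (B : 'M[F]_(k, n)) (w : 'cV[F]_k) :
  row_free B -> (#|[set v | B *m v == w]| * #|F| ^ k = #|F| ^ n)%N.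
Proof.
move=> /row_freeP[D BD].
have cardV (l : nat) : (#|{: 'cV[F]_l}| = #|F| ^ l)%N by rewrite card_mx muln1.
rewrite -!cardV -[RHS]sum1_card (partition_big (mulmx B) predT) //=.
(* The fibres of [mulmx B] are translates of each other, hence equinumerous. *)
have fiber w' : (\sum_(v : 'cV_n | B *m v == w') 1 = #|[set v | B *m v == w]|)%N.
  rewrite sum1_card -[RHS](card_imset _ (addrI (D *m (w' - w)))).
  apply: eq_card => v; rewrite -[LHS]/(B *m v == w'); apply/eqP/imsetP => [Bv|[v']].
    exists (v - D *m (w' - w)); last by rewrite addrC subrK.
    by rewrite inE mulmxBr mulmxA BD mul1mx Bv opprB addrC subrK.
  rewrite inE => /eqP Bv ->; rewrite mulmxDr mulmxA BD mul1mx Bv.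
  by rewrite subrK.
under eq_bigr => w' _ do rewrite fiber.
by rewrite sum_nat_const mulnC.
Qed.

(** The selected rows, indexed by the pairs [(i, j)] with [j < d i], are stacked into one matrix
    [B]. Independence says that [B] is row-free, and [card_solutions] applies. *)
Lemma rows_indep_card (F : finFieldType) (s n : nat) (C : 'I_s -> 'M[F]_n.+1)
    (d : 'I_s -> nat) (w : 'I_s -> nat -> F) :
  rows_indep C d ->
  (#|[set v : 'cV_n.+1 | [forall i, [forall j : 'I_(d i),
        ((C i *m v) (inord j) 0 == w i j)%R]]]| * #|F| ^ (\sum_i d i) = #|F| ^ n.+1)%N.
Proof.
move=> indep; pose T := {i : 'I_s & 'I_(d i)}.
have cT : #|{: T}| = (\sum_i d i)%N.
  rewrite card_tagged sumnE big_map big_enum.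
  by apply: eq_bigr => i _; rewrite card_ord.
pose row_of (t : T) k := C (tag t) (inord (tagged t)) k.
pose B : 'M[F]_(#|{: T}|, n.+1) := \matrix_(t, k) row_of (enum_val t) k.
have freeB : row_free B.
  rewrite -kermx_eq0; apply/rowV0P => v /sub_kermxP vB.
  (* The kernel vector is extended by 0 to all natural [j], as [rows_indep] quantifies over such
     families. *)
  pose c i j := if insub j is Some j'
    then v 0 (enum_rank (Tagged (fun i => 'I_(d i)) (i := i) j')) else 0.
  have cE i (j : 'I_(d i)) : c i j = v 0 (enum_rank (Tagged (fun i => 'I_(d i)) j)).
    by rewrite /c valK.
  have c0 : forall i (j : 'I_(d i)), c i j = 0.
    apply: indep => k; have /(congr1 (fun M : 'rV_n.+1 => M 0 k)) := vB.
    rewrite !mxE => vB0; rewrite -[RHS]vB0 [RHS](reindex enum_rank) /=; last first.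
      by exists enum_val => t _; rewrite ?enum_rankK ?enum_valK.
    rewrite (sig_big_dep (J := fun i => 'I_(d i))) /=.
    apply: eq_bigr => -[i j] _.
    by rewrite cE mxE enum_rankK.
  apply/rowP => t; rewrite !mxE -[t]enum_valK.
  by case: (enum_val t) => i j; rewrite -cE c0.
pose w' (t : T) := w (tag t) (tagged t).
rewrite -cT -(card_solutions (\col_t w' (enum_val t)) freeB).
congr (_ * _)%N; apply: eq_card => v; rewrite !inE.
apply/forallP/eqP => [H|H i].
  apply/colP => t; have /forallP/(_ (tagged (enum_val t)))/eqP := H (tag (enum_val t)).
  by rewrite !mxE /w' => <-; apply: eq_bigr => k _; rewrite mxE.
apply/forallP => j; pose t := enum_rank (Tagged (fun i => 'I_(d i)) j).
have /(congr1 (fun M : 'cV_(#|{: T}|) => M t 0)) := H.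
rewrite !mxE enum_rankK /w' /= => <-; apply/eqP.
by apply: eq_bigr => k _; rewrite mxE enum_rankK.
Qed.

(** * Digit expansions and elementary intervals *)

(* The integer whose base-[Q] digits, most significant first, are
   [z 0, ..., z (d - 1)]. *)
Fixpoint digit_prefix (Q : nat) (z : nat -> nat) (d : nat) : nat :=
  if d is d'.+1 then (digit_prefix Q z d' * Q + z d')%N else 0%N.

Section DigitPrefix.
Variables (Q : nat) (z : nat -> nat).
Hypothesis zQ : forall j, (z j < Q)%N.

Lemma digit_prefix_lt d : (digit_prefix Q z d < Q ^ d)%N.
Proof.
elim: d => //= d IH; rewrite expnSr (leq_trans (n := (digit_prefix Q z d).+1 * Q)) //.
  by rewrite mulSn addnC ltn_add2r.
by rewrite leq_mul2r IH orbT.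
Qed.

Lemma digit_prefix_divn d t :
  (digit_prefix Q z (d + t) %/ Q ^ t = digit_prefix Q z d)%N.
Proof.
have Q0 : (0 < Q)%N by apply: leq_ltn_trans (zQ 0).
elim: t => [|t IH]; first by rewrite addn0 divn1.
by rewrite addnS expnS divnMA /= divnMDl // (divn_small (zQ _)) addn0 IH.
Qed.

Lemma digit_prefixP a d : (a < Q ^ d)%N ->
  digit_prefix Q z d = a <-> forall j, (j < d)%N -> z j = (a %/ Q ^ (d - j.+1) %% Q)%N.
Proof.
have Q0 : (0 < Q)%N by apply: leq_ltn_trans (zQ 0).
elim: d a => [|d IH] a /= ad; first by case: a ad.
have {}IH : digit_prefix Q z d = (a %/ Q)%N <->
    forall j, (j < d)%N -> z j = (a %/ Q ^ (d.+1 - j.+1) %% Q)%N.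
  have dE j : (j < d)%N -> (a %/ Q %/ Q ^ (d - j.+1) = a %/ Q ^ (d.+1 - j.+1))%N.
    by move=> jd; rewrite -divnMA -expnS subSS -subSn.
  have [H1 H2] : _ <-> _ := IH (a %/ Q)%N ltac:(by rewrite ltn_divLR // -expnSr).
  split=> [/H1 H j jd|H]; first by rewrite -dE // H.
  by apply: H2 => j jd; rewrite dE // H.
have aE := divn_eq a Q; split.
  move=> E j; have [pE zE] : digit_prefix Q z d = (a %/ Q)%N /\ z d = (a %% Q)%N.
    by rewrite -E divnMDl // divn_small // addn0 modnMDl modn_small.
  rewrite ltnS leq_eqVlt => /orP[/eqP ->|]; first by rewrite subnn divn1.
  by move: j; apply/IH.
move=> H; rewrite [RHS]aE; congr (_ * _ + _)%N.
  by apply/IH => j jd; apply: H; apply: ltnW.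
by rewrite H // subnn divn1.
Qed.

Lemma digit_prefix_sum (R : numFieldType) m :
  \sum_(j < m) (z j)%:R / Q%:R ^+ j.+1 = (digit_prefix Q z m)%:R / Q%:R ^+ m :> R.
Proof.
have Q0 : Q%:R != 0 :> R by rewrite pnatr_eq0 -lt0n; apply: leq_ltn_trans (zQ 0).
elim: m => [|m IH]; first by rewrite big_ord0 mul0r.
rewrite big_ord_recr /= IH natrD natrM mulrDl; congr (_ + _).
by rewrite exprSr -mulf_div divff // mulr1.
Qed.

(** After scaling by [Q ^ m], membership says that the quotient of the full digit integer by
    [Q ^ (m - d)] is [a], and this quotient is the prefix of length [d]. *)
Lemma digit_prefix_itv (R : numFieldType) a d m : (d <= m)%N ->
  (a%:R / Q%:R ^+ d <= (\sum_(j < m) (z j)%:R / Q%:R ^+ j.+1 : R)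
     < a.+1%:R / Q%:R ^+ d)
  = (digit_prefix Q z d == a).
Proof.
move=> dm; rewrite digit_prefix_sum.
have Q0 : (0 < Q)%N by apply: leq_ltn_trans (zQ 0).
have QR k : 0 < Q%:R ^+ k :> R by rewrite exprn_gt0 // ltr0n.
have scale b : b%:R / Q%:R ^+ d = (b * Q ^ (m - d))%:R / Q%:R ^+ m :> R.
  have -> : Q%:R ^+ m = Q%:R ^+ d * Q%:R ^+ (m - d) :> R by rewrite -exprD subnKC.
  by rewrite natrM natrX -mulf_div divff ?mulr1 // gt_eqF.
rewrite !scale ler_pM2r ?invr_gt0 // ltr_pM2r ?invr_gt0 // ler_nat ltr_nat.
rewrite -leq_divRL ?expn_gt0 ?Q0 // -ltn_divLR ?expn_gt0 ?Q0 //.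
by rewrite -{1 3}(subnKC dm) digit_prefix_divn ltnS -eqn_leq eq_sym.
Qed.
End DigitPrefix.

(** * Restriction of scalars for generating matrices *)

Lemma rows_indep_restriction (F L : finFieldType) (f : F -> L) (r n N s : nat)
    (psi : L -> 'rV[F]_r) (C : 'I_s -> 'M[L]_n.+1) :
  zmod_morphism f -> monoid_morphism f -> zmod_morphism psi ->
  (forall a x, psi (f a * x) = a *: psi x) -> injective psi ->
  N = (r * n)%N ->
  exists C' : 'I_s -> 'M[F]_N.+1, forall d : 'I_s -> nat,
    (forall i, (d i <= n.+1)%N) -> (forall i, (d i <= N.+1)%N) ->
    rows_indep C d -> rows_indep C' d.
Proof.
move=> fA fM psiA psiZ psi_inj NE.
pose fR : {rmorphism F -> L} := HB.pack f (GRing.isZmodMorphism.Build _ _ f fA)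
  (GRing.isMonoidMorphism.Build _ _ f fM).
pose psiR : {additive L -> 'rV[F]_r} :=
  HB.pack psi (GRing.isZmodMorphism.Build _ _ psi psiA).
(* [scale i j] normalizes the first coordinate of row [j] of [C i] to 0 or 1. *)
pose scale i j := let x := C i (inord j) 0 in if x == 0 then 1 else x^-1.
have scale_neq0 i j : scale i j != 0.
  by rewrite /scale; case: ifPn => [_|x0]; rewrite ?oner_neq0 ?invr_eq0.
have scaleE i j : scale i j * C i (inord j) 0 = fR (C i (inord j) 0 != 0)%:R.
  rewrite /scale; case: eqVneq => [->|x0]; first by rewrite mulr0 rmorph0.
  by rewrite mulVf // rmorph1.
(* Column 0 is the normalized first coordinate; column [(r * l + t).+1] is component [t] of the
   rescaled entry in column [l.+1]. The default 0 occurs only for [r = 0]. *)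
pose col_of (k : nat) i j : F :=
  if k is k'.+1 then
    (if insub (k' %% r)%N is Some t
     then psi (scale i j * C i (inord j) (inord (k' %/ r).+1)) 0 t else 0)
  else (C i (inord j) 0 != 0)%:R.
(* One choice of [C'] serves all [d]. Rows of index above [n] are filler, where [inord] returns its
   default 0. *)
exists (fun i => \matrix_(j, k) col_of k i j) => d dn dN indep c c0.
have {}c0 k : (k < N.+1)%N -> \sum_i \sum_(j < d i) c i j * col_of k i j = 0.
  move=> kN; rewrite -[RHS](c0 (Ordinal kN)); apply: eq_bigr => i _.
  apply: eq_bigr => j _; rewrite mxE inordK //.
  exact: leq_trans (ltn_ord j) (dN i).
suff c'0 : forall i (j : 'I_(d i)), fR (c i j) * scale i j = 0.
  move=> i j; have /eqP := c'0 i j.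
  by rewrite mulf_eq0 (negPf (scale_neq0 _ _)) orbF fmorph_eq0 => /eqP.
apply: (indep (fun i j => fR (c i j) * scale i j)) => k.
(* In column 0 the rescaled entries lie in the image of [F], so the relation over [L] is the image
   of the one over [F]. *)
have [k' ->|->] := unliftP 0 k; last first.
  transitivity (fR (\sum_i \sum_(j < d i) c i j * col_of 0%N i j)); last first.
    by rewrite c0 // rmorph0.
  rewrite rmorph_sum; apply: eq_bigr => i _; rewrite rmorph_sum.
  by apply: eq_bigr => j _; rewrite -mulrA scaleE rmorphM.
(* In the other columns the relation is checked component by component, using that [psi] is
   injective and [F]-linear. *)
apply: psi_inj; rewrite -[psi 0]/(psiR 0) raddf0; apply/rowP => t.
have r_gt0 : (0 < r)%N by apply: leq_ltn_trans (ltn_ord t).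
rewrite [RHS]mxE -[RHS](c0 (r * k' + t).+1); last first.
  rewrite NE ltnS (leq_trans (n := r * k'.+1)%N) ?leq_mul2l ?ltn_ord ?orbT //.
  by rewrite mulnS addnC ltn_add2r.
rewrite -[psi _]/(psiR _) raddf_sum summxE; apply: eq_bigr => i _.
rewrite raddf_sum summxE; apply: eq_bigr => j _.
rewrite /= -mulrA psiZ mxE mulnC modnMDl modn_small // valK.
rewrite divnMDl // divn_small // addn0.
by congr (_ * psi (_ * C i _ _) _ _); apply/val_inj; rewrite /= inordK // ltnS.
Qed.

(** * Digital nets: the net property as independence of rows *)

Lemma lebesgueN_elementary_interval (R : realType) (s b : nat) (d a : 'I_s -> nat) :
  (0 < b)%N ->
  lebesgueN (elementary_interval (R := R) b d a) = ((b%:R ^+ \sum_i d i)^-1)%:E.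
Proof.
move=> b_gt0; rewrite lebesgueN_box.
  rewrite -prodrXr -prodfV; congr _%:E; apply: eq_bigr => i _.
  by rewrite -mulrBl -natrB // subSnn mul1r.
by move=> i; rewrite ler_pM2r ?ler_nat // invr_gt0 exprn_gt0 // ltr0n.
Qed.

Lemma elementary_volume_ge (R : realType) (b u m D : nat) : (1 < b)%N ->
  ((b%:R ^ (u%:Z - m%:Z))%:E <= ((b%:R ^+ D)^-1)%:E :> \bar R)%E = (D + u <= m)%N.
Proof.
move=> b_gt1; have b0 : (0 : R) < b%:R by rewrite ltr0n ltnW.
rewrite lee_fin expfzDr ?gt_eqF // -exprnN -exprnP.
rewrite -[X in _ <= X]mul1r ler_pdivrMr ?exprn_gt0 // mulrAC ler_pdivlMr ?exprn_gt0 //.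
by rewrite mul1r -exprD ler_eXn2l ?ltr1n // addnC.
Qed.

Section DigitalNet.
Variables (R : realType) (F : finFieldType) (n s : nat).
Variables (C : 'I_s -> 'M[F]_n.+1) (eta : 'I_n.+1 -> 'I_#|F| -> F).
Variable kappa : 'I_s -> 'I_n.+1 -> F -> 'I_#|F|.
Hypothesis eta_bij : forall k, bijective (eta k).
Hypothesis kappa_bij : forall i j, bijective (kappa i j).

Let coords (k : nat) : 'cV[F]_n.+1 := \col_(l < n.+1) eta l (digit F k l).

Let digits (v : 'cV[F]_n.+1) i j : nat := kappa i (inord j) ((C i *m v) (inord j) 0).

Let digits_lt v i j : (digits v i j < #|F|)%N.
Proof. exact: ltn_ord. Qed.

Lemma coords_bij : bijective (fun k : 'I_(#|F| ^ n.+1) => coords k).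
Proof.
apply: inj_card_bij; last by rewrite card_mx card_ord muln1.
move=> k k' kk'.
have F_gt0 : (0 < #|F|)%N := ltnW (finNzRing_gt1 F).
(* The digits of [k], most significant first, whence the reversed index [n.+1 - j.+1]. *)
pose z j := (k %/ #|F| ^ (n.+1 - j.+1) %% #|F|)%N.
have zF j : (z j < #|F|)%N by rewrite ltn_pmod.
apply/val_inj; transitivity (digit_prefix #|F| z n.+1).
  by apply/esym/(digit_prefixP zF (ltn_ord k)).
apply/(digit_prefixP zF (ltn_ord k')) => j jn; rewrite /z.
have jn' : (n.+1 - j.+1 < n.+1)%N by rewrite ltn_subrL.
have /(congr1 (fun v : 'cV_n.+1 => v (Ordinal jn') 0)) := kk'.
by rewrite !mxE => /(bij_inj (eta_bij _)) /(congr1 val).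
Qed.

Lemma digital_point_in (k : nat) (d a : 'I_s -> nat) :
  (forall i, (d i <= n.+1)%N) ->
  digital_point R C eta kappa k \in elementary_interval #|F| d a <->
  forall i, digit_prefix #|F| (digits (coords k) i) (d i) = a i.
Proof.
move=> dn.
have E i : tnth (digital_point R C eta kappa k) i =
    \sum_(j < n.+1) (digits (coords k) i j)%:R / #|F|%:R ^+ j.+1.
  rewrite tnth_mktuple; apply: eq_bigr => j _.
  by rewrite /digits inord_val.
rewrite inE /elementary_interval /=; split=> H i.
  by apply/eqP; rewrite -(digit_prefix_itv (digits_lt _ _) R _ (dn i)) -E.
by rewrite E digit_prefix_itv // H.
Qed.

Lemma digital_point_itv k i : 0 <= tnth (digital_point R C eta kappa k) i < 1.
Proof.
(* The unit cube is the elementary interval with all [d i] and [a i] zero. *)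
have := @digital_point_in k (fun=> 0%N) (fun=> 0%N) (fun=> leq0n _).
move=> [_ H]; have /set_mem/(_ i) := H (fun=> erefl).
by rewrite expr0 divr1 divr1.
Qed.

Lemma rows_indep_of_net (u : nat) (e : 'I_s -> nat) :
  is_net (b := #|F|) (m := n.+1) u e (fun k => digital_point R C eta kappa k) ->
  forall d, (forall i, (e i %| d i)%N) -> (\sum_i d i + u <= n.+1)%N -> rows_indep C d.
Proof.
move=> [_ _ net] d ed Du.
have F_gt1 := finNzRing_gt1 F.
have dn i : (d i <= n.+1)%N.
  by rewrite (leq_trans _ Du) // (bigD1 i) //= -addnA leq_addr.
apply: rows_indep_of_surj => w.
(* The leading digits encode the target [w] through [kappa]. *)
pose z i j : nat := kappa i (inord j) (w i j).
have zF i j : (z i j < #|F|)%N by exact: ltn_ord.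
pose a i := digit_prefix #|F| (z i) (d i).
have aF i : (a i < #|F| ^ d i)%N by apply: digit_prefix_lt.
have := net d a aF ed; cbv zeta.
rewrite lebesgueN_elementary_interval ?(ltnW F_gt1) // elementary_volume_ge // Du.
move=> /(_ isT).
(* The elementary interval [a] has positive volume, so it contains a point,
   whose digit vector is the required preimage of [w]. *)
have [k kJ _|noJ] := pickP [pred k : 'I_(#|F| ^ n.+1) |
    digital_point R C eta kappa k \in elementary_interval #|F| d a]; last first.
  rewrite eq_card0 // => /esym/eqP; rewrite -EFinM eqe gt_eqF // divr_gt0 //.
    by rewrite ltr0n expn_gt0 ltnW.
  by rewrite exprn_gt0 // ltr0n ltnW.
have {}kJ := (digital_point_in k a dn).1 kJ.
exists (coords k) => i j.
have /(digit_prefixP (digits_lt _ _) (aF i))/(_ _ (ltn_ord j)) := kJ i.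
have /(digit_prefixP (zF i) (aF i))/(_ _ (ltn_ord j)) <- := erefl (a i).
by move=> /val_inj /(bij_inj (kappa_bij _ _)).
Qed.

(** Points in an elementary interval correspond to solutions of the linear system prescribing the
    leading digits, and independence makes the number of solutions exact. *)
Lemma net_of_rows_indep (u : nat) (e : 'I_s -> nat) : (u <= n.+1)%N ->
  (forall d, (forall i, (e i %| d i)%N) -> (\sum_i d i + u <= n.+1)%N ->
     rows_indep C d) ->
  is_net (b := #|F|) (m := n.+1) u e (fun k => digital_point R C eta kappa k).
Proof.
move=> un indep; split=> // [k i|d a aF ed J]; first exact: digital_point_itv.
have F_gt1 := finNzRing_gt1 F.
rewrite lebesgueN_elementary_interval ?(ltnW F_gt1) // elementary_volume_ge // => Du.
have dn i : (d i <= n.+1)%N.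
  by rewrite (leq_trans _ Du) // (bigD1 i) //= -addnA leq_addr.
have [kinv kinvK kinvK'] : exists2 kinv : 'I_s -> 'I_n.+1 -> 'I_#|F| -> F,
    (forall i j, cancel (kappa i j) (kinv i j)) &
    (forall i j, cancel (kinv i j) (kappa i j)).
  pose g i j := sval (cid2 (let: Bijective g H1 H2
    := kappa_bij i j in ex_intro2 _ _ g H1 H2)).
  by exists g => i j; rewrite /g; case: cid2.
have digP x : (x %% #|F| < #|F|)%N by rewrite ltn_pmod // ltnW.
(* The digits of [a i] are decoded to field elements, giving the right-hand side of the system. *)
pose w i j := kinv i (inord j) (Ordinal (digP (a i %/ #|F| ^ (d i - j.+1)))%N).
have := rows_indep_card w (indep d ed Du).
set S := [set v | _] => cardS.
have -> : #|[pred k : 'I_(#|F| ^ n.+1) | digital_point R C eta kappa k \in J]| = #|S|.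
  have [g gK gK'] := coords_bij.
  rewrite -(on_card_preimset (f := fun k : 'I_(#|F| ^ n.+1) => coords k)); last first.
    by exists g => x _.
  apply: eq_card => k; rewrite !inE.
  apply/idP/forallP => [kJ i|H].
    apply/forallP => j.
    have /(digit_prefixP (digits_lt _ _) (aF i))/(_ _ (ltn_ord j))
      := (digital_point_in k a dn).1 kJ i.
    move=> E; rewrite -(inj_eq (bij_inj (kappa_bij i (inord j)))) /w kinvK'.
    exact/eqP/val_inj.
  apply/(digital_point_in k a dn) => i; apply/(digit_prefixP (digits_lt _ _) (aF i)).
  move=> j jd; have /forallP/(_ (Ordinal jd))/eqP := H i.
  by rewrite /digits => ->; rewrite /w kinvK'.
rewrite -cardS natrM natrX -EFinM mulfK // expf_neq0 // pnatr_eq0.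
by rewrite -lt0n ltnW.
Qed.
End DigitalNet.

(* Descent of the net to the smaller field *)
Local Close Scope ring_scope.

Theorem theorem3 (R : realType) (q m s u r : nat) (e : 'I_s -> nat)
    (Fq FQ : finFieldType)
    (hq : prime_power q)
    (hm : (1 <= m)%N) (hs : (1 <= s)%N) (hr : (2 <= r)%N)
    (he : forall i, (1 <= e i)%N)
    (hFq : #|Fq| = q) (hFQ : #|FQ| = (q ^ r)%N) :
  (exists x : 'I_(#|FQ| ^ m) -> s.-tuple R, is_digital_net (F := FQ) (m := m) u e x) ->
  exists x : 'I_(#|Fq| ^ (r * m - (r - 1))) -> s.-tuple R,
    is_digital_net (F := Fq) (m := r * m - (r - 1))
      ((r - 1) * m - (r - 1) + u) e x.
Proof.
case: m hm => // n _ [x [[C [eta [kappa [eta_bij kappa_bij xE]]]] net]].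
have r_gt0 : 0 < r by exact: ltnW.
have NE : r * n.+1 - (r - 1) = (r * n).+1 by rewrite mulnS; lia.
have UE : (r - 1) * n.+1 - (r - 1) + u = (r - 1) * n + u by rewrite mulnS addKn.
have rnE : r * n = (r - 1) * n + n by rewrite mulnBl mul1n subnK // leq_pmull.
have un : u <= n.+1 by case: net.
have {xE}net : is_net (b := #|FQ|) (m := n.+1) u e
    (fun k => digital_point R C eta kappa k).
  by rewrite (_ : (fun k => _) = x) //; apply/funext => k; rewrite xE.
have [p [k [pr_p _ qE]]] := hq.
rewrite -hFq in qE hFQ.
have [f [fA fM]] := finField_embedding pr_p r_gt0 qE hFQ.
have [psi [psiA psiZ psi_inj]] := finField_coordinates fA fM hFQ.
have [C' C'_indep] := rows_indep_restriction C fA fM psiA psiZ psi_inj (erefl (r * n)).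
rewrite NE UE.
(* Any digit bijections would serve: the net property is derived from the rows of [C'] alone. *)
pose eta' (_ : 'I_(r * n).+1) : 'I_#|Fq| -> Fq := enum_val.
pose kappa' (_ : 'I_s) (_ : 'I_(r * n).+1) : Fq -> 'I_#|Fq| := enum_rank.
have eta'_bij k' : bijective (eta' k') by exact: enum_val_bij.
have kappa'_bij i j : bijective (kappa' i j) by exact: enum_rank_bij.
exists (fun k => digital_point R C' eta' kappa' k); split.
  by exists C', eta', kappa'.
apply: net_of_rows_indep => // [|d ed Du]; first by rewrite rnE; lia.
(* With [m = n.+1], the new dimension minus the new quality parameter is [(r * n).+1 - ((r - 1) * n
   + u) = n.+1 - u], so both nets test the same [d]. *)
have Du' : (\sum_i d i + u <= n.+1)%N.
  by move: Du; rewrite rnE; move: (\sum_i d i)%N ((r - 1) * n); lia.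
have dn i : d i <= n.+1.
  by rewrite (leq_trans _ Du') // (bigD1 i) //= -addnA leq_addr.
apply: C'_indep => // [i|]; first by rewrite (leq_trans (dn i)) // ltnS leq_pmull.
exact: (rows_indep_of_net kappa_bij net ed Du').
Qed.
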